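(* Let $(X,\widehat{d}_X)$ and $(Y,\widehat{d}_Y)$ be two non-Archimedean metric spaces and $\varepsilon>0$. Then: (1) If $\widehat{d}_{GH}(X,Y)<\varepsilon$, then there exists a strong $\varepsilon$-isometry from $X$ to $Y$. (2) If there exists a strong $\varepsilon$-isometry from $X$ to $Y$, then $\widehat{d}_{GH}(X,Y)\le\varepsilon$.
   Context: A non-Archimedean metric space $(X,\widehat{d}_X)$ is a set with a metric satisfying the strong triangle inequality $\widehat{d}_X(x,z)\le\max\{\widehat{d}_X(x,y),\widehat{d}_X(y,z)\}$. The non-Archimedean Gromov-Hausdorff distance is $\widehat{d}_{GH}(X,Y)=\inf\{\widehat{d}_{H}(f(X),g(Y))\}$, the infimum being over all non-Archimedean metric spaces $(Z,\widehat{d}_Z)$ and all isometric embeddings $f:X\hookrightarrow Z$, $g:Y\hookrightarrow Z$, where $\widehat{d}_H$ is the Hausdorff distance between subsets of $Z$ (it may be $\infty$). A subset $S$ of a metric space $(Y,d)$ is an $\varepsilon$-net if $\operatorname{dist}(y,S)=\inf_{s\in S}d(y,s)<\varepsilon$ for all $y\in Y$. For a map $f:X\to Y$, $\operatorname{dis}f=\sup_{x_1,x_2\in X}|\widehat{d}_Y(f(x_1),f(x_2))-\widehat{d}_X(x_1,x_2)|$. A (possibly non-continuous) map $f:X\to Y$ is an $\varepsilon$-isometry if $\operatorname{dis}f<\varepsilon$ and $f(X)$ is an $\varepsilon$-net in $Y$. An $\varepsilon$-isometry $f:X\to Y$ is a strong $\varepsilon$-isometry if it satisfies both of the following. ($SI_1$)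 For $x\in X$ and $y\in Y$, if $\widehat{d}_Y(y,f(x))\ge\varepsilon$, then there exists $x'\in X$ such that $\widehat{d}_Y(y,f(x'))<\varepsilon$ and $\widehat{d}_X(x,x')=\widehat{d}_Y(y,f(x))$. ($SI_2$) For $x_1,x_2\in X$, if $\widehat{d}_X(x_1,x_2)\ne\widehat{d}_Y(f(x_1),f(x_2))$, then $\widehat{d}_X(x_1,x_2)<\varepsilon$. *)

(* Defs.v *)
From HB Require Import structures.
From mathcomp Require Import all_boot all_order all_algebra.
From mathcomp Require Import all_classical all_reals all_analysis.

Set Implicit Arguments.
Unset Strict Implicit.
Unset Printing Implicit Defensive.

Import Order.TTheory GRing.Theory Num.Theory.

Local Open Scope classical_set_scope.
Local Open Scope ring_scope.

Definition non_archimedean (R : realType) (T : metricType R) : Prop :=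
  forall x y z : T, mdist x z <= Num.max (mdist x y) (mdist y z).

Definition isometric_embedding (R : realType) (X Z : metricType R)
    (f : X -> Z) : Prop :=
  forall x1 x2 : X, mdist (f x1) (f x2) = mdist x1 x2.

(* Distances to sets are extended reals: the distance to the empty set
   is +oo. *)
Definition set_dist (R : realType) (T : metricType R) (y : T) (S : set T) :
    \bar R :=
  ereal_inf [set (mdist y s)%:E | s in S].

Definition set_nbhd (R : realType) (T : metricType R) (r : R) (S : set T) :
    set T :=
  [set y | (set_dist y S < r%:E)%E].

(* The infimum is +oo when no r is admissible. *)
Definition hausdorff_dist (R : realType) (T : metricType R) (A B : set T) :
    \bar R :=
  ereal_inf [set r%:E | r in
    [set r : R | 0 < r /\ A `<=` set_nbhd r B /\ B `<=` set_nbhd r A]].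

Definition non_archimedean_GH (R : realType) (X Y : metricType R) : \bar R :=
  ereal_inf [set h : \bar R |
    exists (Z : metricType R) (f : X -> Z) (g : Y -> Z),
      [/\ non_archimedean Z, isometric_embedding f, isometric_embedding g
        & h = hausdorff_dist (range f) (range g)]].

Definition eps_net (R : realType) (Y : metricType R) (eps : R) (S : set Y) :
    Prop :=
  forall y : Y, (set_dist y S < eps%:E)%E.

(* For empty X this supremum is -oo rather than 0; since it is only compared
   with positive reals, the difference is immaterial. *)
Definition distortion (R : realType) (X Y : metricType R) (f : X -> Y) :
    \bar R :=
  ereal_sup [set (`|mdist (f p.1) (f p.2) - mdist p.1 p.2|)%:E
            | p in [set: X * X]].

Definition eps_isometry (R : realType) (X Y : metricType R) (eps : R)
    (f : X -> Y) : Prop :=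
  (distortion f < eps%:E)%E /\ eps_net eps (range f).

Definition strong_isometry1 (R : realType) (X Y : metricType R) (eps : R)
    (f : X -> Y) : Prop :=
  forall (x : X) (y : Y), eps <= mdist y (f x) ->
    exists x' : X, mdist y (f x') < eps /\ mdist x x' = mdist y (f x).

Definition strong_isometry2 (R : realType) (X Y : metricType R) (eps : R)
    (f : X -> Y) : Prop :=
  forall x1 x2 : X, mdist x1 x2 <> mdist (f x1) (f x2) -> mdist x1 x2 < eps.

Definition strong_eps_isometry (R : realType) (X Y : metricType R) (eps : R)
    (f : X -> Y) : Prop :=
  [/\ eps_isometry eps f, strong_isometry1 eps f & strong_isometry2 eps f].

(* Main.v *)
From HB Require Import structures.
Require Import Defs.
From mathcomp Require Import all_boot all_order all_algebra.
From mathcomp Require Import all_classical all_reals all_analysis.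

(** (1) Inside an ultrametric space where [range f] and [range g] are
    [r]-close with [r < eps], send [x] to some [y] with [g y] within [r] of
    [f x].  Moving two points by less than [r] does not change their distance
    once it is at least [r]; this gives all the clauses at once.

    (2) A strong [eps]-isometry satisfies
    [max eps d(f x1, f x2) = max eps d(x1, x2)]: if [d(x1, x2) < eps] but
    [D := d(f x1, f x2) >= eps], then (SI1) provides [x'] with
    [d(x1, x') = D] and [d(f x2, f x') < eps]; the isosceles property gives
    [d(x2, x') = D >= eps], contradicting (SI2).  Hence
    [d(x, y) := max eps d(f x, y)] extends the metrics of [X] and [Y] to an
    ultrametric on the disjoint union. *)

Set Implicit Arguments.
Unset Strict Implicit.
Unset Printing Implicit Defensive.

Import Order.TTheory GRing.Theory Num.Theory.

Local Open Scope classical_set_scope.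
Local Open Scope ring_scope.

Lemma set_dist_ltP (R : realType) (T : metricType R) (y : T) (S : set T)
    (r : R) :
  (set_dist y S < r%:E)%E <-> exists2 s, S s & mdist y s < r.
Proof.
split=> [/ereal_inf_lt[_ [s Ss <-]]|[s Ss ysr]].
  by rewrite lte_fin; exists s.
by apply: (@le_lt_trans _ _ (mdist y s)%:E);
  [apply: ereal_inf_lbound; exists s | rewrite lte_fin].
Qed.

Lemma set_dist_rangeP (R : realType) (X T : metricType R) (y : T) (f : X -> T)
    (r : R) :
  (set_dist y (range f) < r%:E)%E <-> exists x, mdist y (f x) < r.
Proof.
rewrite set_dist_ltP; split=> [[_ [x _ <-] ?]|[x ?]]; first by exists x.
by exists (f x) => //; exists x.
Qed.

Lemma hausdorff_dist_lt (R : realType) (T : metricType R) (A B : set T)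
    (eps : R) :
  (hausdorff_dist A B < eps%:E)%E ->
  exists2 r, r < eps & A `<=` set_nbhd r B /\ B `<=` set_nbhd r A.
Proof.
by move=> /ereal_inf_lt[_ [r [_ AB] <-]]; rewrite lte_fin; exists r.
Qed.

(** Only radii strictly above [eps] are tested: neighbourhoods are open, and the glued distance
    between the two spaces never drops below [eps]. *)
Lemma hausdorff_dist_le (R : realType) (T : metricType R) (A B : set T)
    (eps : R) : 0 <= eps ->
  (forall r, eps < r -> A `<=` set_nbhd r B /\ B `<=` set_nbhd r A) ->
  (hausdorff_dist A B <= eps%:E)%E.
Proof.
move=> eps0 AB; apply/lee_addgt0Pr => e e0; apply: ereal_inf_lbound.
exists (eps + e) => //=; split; first by rewrite ltr_wpDl.
by apply: AB; rewrite ltrDl.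
Qed.

Lemma isosceles (R : realType) (T : metricType R) (hT : non_archimedean T)
    (x y z : T) :
  mdist y z < mdist x y -> mdist x z = mdist x y.
Proof.
move=> yz_xy; apply/eqP; rewrite eq_le; apply/andP; split.
  by rewrite (le_trans (hT x y z))// ge_max lexx ltW.
have := hT x z y; rewrite le_max => /orP[//|].
by rewrite (metric_sym z) leNgt yz_xy.
Qed.

(** The endpoints are moved one after the other, each by less than the current distance, so
    [isosceles] applies twice. *)
Lemma mdist_perturb (R : realType) (T : metricType R)
    (hT : non_archimedean T) (r : R) (x x' y y' : T) :
  mdist x x' < r -> mdist y y' < r -> r <= mdist x y ->
  mdist x' y' = mdist x y.
Proof.
move=> xx' yy' rxy.
have xy' : mdist x y' = mdist x y by apply: isosceles (lt_le_trans yy' rxy).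
rewrite -xy' metric_sym [RHS]metric_sym; apply: isosceles => //.
by rewrite [ltRHS]metric_sym xy' (lt_le_trans xx').
Qed.

Lemma exists_strong_eps_isometry (R : realType) (X Y Z : metricType R)
    (hZ : non_archimedean Z) (f : X -> Z) (g : Y -> Z) (r eps : R) :
  isometric_embedding f -> isometric_embedding g -> r < eps ->
  range f `<=` set_nbhd r (range g) ->
  range g `<=` set_nbhd r (range f) ->
  exists h : X -> Y, strong_eps_isometry eps h.
Proof.
move=> fI gI reps fg gf.
have hY : non_archimedean Y by move=> x y z; rewrite -!gI; exact: hZ.
have /choice[h fgh] : forall x, exists y, mdist (f x) (g y) < r.
  by move=> x; apply/set_dist_rangeP/fg; exists x.
have preim y : exists x, mdist (g y) (f x) < r.
  by apply/set_dist_rangeP/gf; exists y.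
have hfar x1 x2 : r <= mdist x1 x2 -> mdist (h x1) (h x2) = mdist x1 x2.
  by rewrite -fI -gI; exact: mdist_perturb.
(* The same perturbation run backwards, from the points [g (h x)] to the points [f x]. *)
have hfar' x1 x2 : r <= mdist (h x1) (h x2) ->
    mdist (h x1) (h x2) = mdist x1 x2.
  by rewrite -fI -gI => ?; apply/esym/(mdist_perturb hZ (r := r)) => //;
    rewrite metric_sym.
have near_h y x : mdist (g y) (f x) < r -> mdist y (h x) < r.
  move=> yx; rewrite -gI (le_lt_trans (hZ _ (f x) _))//.
  by rewrite gt_max yx fgh.
exists h; split; first split.
(* A supremum of values below [eps] could equal [eps], so the bound is proved with [r < eps]. If
   either distance is at least [r], the two agree; otherwise both lie between 0 and [r]. *)
- apply: (@le_lt_trans _ _ r%:E); last by rewrite lte_fin.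
  apply: ge_ereal_sup => _ [[x1 x2] _ <-] /=; rewrite lee_fin.
  have [/hfar ->|lt1] := leP r (mdist x1 x2).
    by rewrite subrr normr0 (le_trans _ (ltW (fgh x1)))// mdist_ge0.
  have [/hfar' ->|lt2] := leP r (mdist (h x1) (h x2)).
    by rewrite subrr normr0 (le_trans _ (ltW (fgh x1)))// mdist_ge0.
  by rewrite ler_distl; apply/andP; split;
    rewrite ?lerBlDr (le_trans (ltW lt1), le_trans (ltW lt2))// ?lerDl ?lerDr
      ?mdist_ge0.
- move=> y; apply/set_dist_rangeP; have [x yx] := preim y.
  by exists x; exact: lt_trans (near_h _ _ yx) reps.
(* For (SI1), [x'] is chosen with [f x'] close to [g y]. Then [h x'] is close to [y], so [h x] is
   equally far from both, and [hfar'] carries this distance back to [X]. *)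
- move=> x y eyhx; have [x' /near_h yx'] := preim y.
  exists x'; split; first exact: lt_trans reps.
  have hxx' : mdist (h x) (h x') = mdist y (h x).
    rewrite [RHS]metric_sym; apply: isosceles => //.
    by rewrite [ltRHS]metric_sym (lt_le_trans yx')// (le_trans (ltW reps)).
  by rewrite -hxx' -hfar'// hxx' (le_trans (ltW reps)).
- move=> x1 x2 neq; rewrite (lt_trans _ reps)// ltNge; apply/negP => le_r.
  by apply: neq; rewrite hfar.
Qed.

Lemma strong_eps_isometry_max (R : realType) (X Y : metricType R)
    (hX : non_archimedean X) (eps : R) (f : X -> Y) :
  strong_eps_isometry eps f ->
  forall x1 x2 : X,
    Num.max eps (mdist (f x1) (f x2)) = Num.max eps (mdist x1 x2).
Proof.
move=> [_ si1 si2] x1 x2.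
(* Contrapositive of (SI2). *)
have far a b : eps <= mdist a b -> mdist (f a) (f b) = mdist a b.
  by move=> ab; apply: contrapT => /nesym/si2; rewrite ltNge ab.
have [le12|lt12] := leP eps (mdist x1 x2); first by rewrite far// max_r.
rewrite max_l// leNgt; apply/negP => /ltW; rewrite metric_sym.
move=> /[dup] eD /si1[x' [x2x' x1x']].
have x2x'E : mdist x' x2 = mdist x' x1.
  by apply: isosceles => //; rewrite (metric_sym x') x1x' (lt_le_trans lt12).
have : eps <= mdist x' x2 by rewrite x2x'E metric_sym x1x'.
move=> /[dup] le_x' /far; rewrite metric_sym => E.
by move: x2x'; rewrite E ltNge le_x'.
Qed.

(** Nonnegativity follows from [0 = d x x <= max (d x y) (d y x) = d x y], and then the maximum is
    at most the sum, which gives the triangle inequality. *)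
Lemma metric_of_dist (R : realType) (T : Type) (d : T -> T -> R) :
  (forall x, d x x = 0) -> (forall x y, d x y = 0 -> x = y) ->
  (forall x y, d x y = d y x) ->
  (forall y x z, d x z <= Num.max (d x y) (d y z)) ->
  exists (Z : metricType R) (i : T -> Z),
    non_archimedean Z /\ forall x y, mdist (i x) (i y) = d x y.
Proof.
move=> d0 dpos dsym dmax.
have dge0 x y : 0 <= d x y.
  by rewrite -(d0 x) (le_trans (dmax y x x))// (dsym y) maxxx.
have dtri y x z : d x z <= d x y + d y z.
  by rewrite (le_trans (dmax y x z))// ge_max lerDl lerDr !dge0.
(* Equality and choice structures on the bare type [T] are obtained classically. *)
pose C : choiceType := HB.pack T (gen_eqMixin T) (gen_choiceMixin T).
pose Z : metricType R := HB.pack C (isMetric.Build R C d0 dpos dsym dtri).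
by exists Z, id; split => // x y z; exact: dmax.
Qed.

(** The floor [eps] on mixed distances keeps the two copies apart, so that no points of [X] and [Y]
    are identified. *)
Definition glue_dist (R : realType) (X Y : metricType R) (eps : R) (f : X -> Y)
    (u v : X + Y) : R :=
  match u, v with
  | inl x, inl x' => mdist x x'
  | inl x, inr y | inr y, inl x => Num.max eps (mdist (f x) y)
  | inr y, inr y' => mdist y y'
  end.

Lemma glue_dist_sym (R : realType) (X Y : metricType R) (eps : R)
    (f : X -> Y) (u v : X + Y) :
  glue_dist eps f u v = glue_dist eps f v u.
Proof. by case: u v => [x|y] [x'|y'] //=; rewrite metric_sym. Qed.

(** Under a maximum with [eps], [d(x, x')] may be replaced by [d(f x, f x')]; this reduces triples
    with two points in [X] and one in [Y] to the ultrametric inequality of [Y]. *)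
Lemma glue_dist_max (R : realType) (X Y : metricType R)
    (hX : non_archimedean X) (hY : non_archimedean Y) (eps : R)
    (f : X -> Y) :
  strong_eps_isometry eps f ->
  forall v u w : X + Y,
    glue_dist eps f u w <=
    Num.max (glue_dist eps f u v) (glue_dist eps f v w).
Proof.
move=> /(strong_eps_isometry_max hX) fmax.
have llr x x' y : Num.max eps (mdist (f x) y) <=
    Num.max (mdist x x') (Num.max eps (mdist (f x') y)).
  rewrite maxCA maxA -fmax -maxA ge_max !le_max lexx /=.
  by have := hY (f x) (f x') y; rewrite le_max => /orP[]->; rewrite ?orbT.
have lrr x y y' : Num.max eps (mdist (f x) y') <=
    Num.max (Num.max eps (mdist (f x) y)) (mdist y y').
  rewrite -maxA ge_max !le_max lexx /=.
  by have := hY (f x) y y'; rewrite le_max => /orP[]->; rewrite ?orbT.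
case=> [x2|y2] [x1|y1] [x3|y3] /=.
- exact: hX.
- exact: llr.
- by rewrite [leRHS]maxC (metric_sym x2); exact: llr.
- rewrite (le_trans (hY y1 (f x2) y3))// metric_sym ge_max !le_max !lexx.
  by rewrite !orbT.
(* The left side is enlarged so that [fmax] applies; the added [eps] is absorbed by the mixed
   distances on the right. *)
- apply: (@le_trans _ _ (Num.max eps (mdist x1 x3))).
    by rewrite le_max lexx orbT.
  rewrite -fmax ge_max !le_max lexx /=.
  have := hY (f x1) y2 (f x3); rewrite le_max (metric_sym y2).
  by move=> /orP[]->; rewrite ?orbT.
- exact: lrr.
- by rewrite [leRHS]maxC (metric_sym y1); exact: lrr.
- exact: hY.
Qed.

Lemma glue_dist_eq0 (R : realType) (X Y : metricType R) (eps : R)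
    (f : X -> Y) (u v : X + Y) :
  0 < eps -> glue_dist eps f u v = 0 -> u = v.
Proof.
move=> eps0; have neq0 a : Num.max eps a <> 0.
  by move=> /eqP; apply/negP; rewrite gt_eqF// lt_max eps0.
by case: u v => [x|y] [x'|y'] //=;
  [move=> /mdist_positivity -> | move=> /neq0 | move=> /neq0
  | move=> /mdist_positivity ->].
Qed.

Lemma non_archimedean_GH_le (R : realType) (X Y : metricType R)
    (hX : non_archimedean X) (hY : non_archimedean Y) (eps : R)
    (f : X -> Y) :
  0 < eps -> strong_eps_isometry eps f ->
  (non_archimedean_GH X Y <= eps%:E)%E.
Proof.
move=> eps0 fS; have [[_ fnet] _ _] := fS.
have d0 u : glue_dist eps f u u = 0.
  by case: u => [x|y] /=; exact: mdistxx.
have [Z [i [hZ iE]]] := metric_of_dist d0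
  (fun u v => @glue_dist_eq0 _ _ _ _ f u v eps0) (glue_dist_sym eps f)
  (glue_dist_max hX hY fS).
apply: (@le_trans _ _ (hausdorff_dist (range (i \o inl)) (range (i \o inr)))).
  apply: ereal_inf_lbound; exists Z, (i \o inl), (i \o inr).
  by split=> // [x1 x2|y1 y2]; rewrite /= iE.
apply: hausdorff_dist_le => [|r epsr]; first exact: ltW.
(* A point [z] of [X] is at glued distance exactly [eps < r] from [f z]; for a point of [Y] the net
   property supplies a partner. *)
split=> _ [z _ <-]; apply/set_dist_rangeP.
  by exists (f z); rewrite iE /= mdistxx gt_max epsr (lt_trans eps0).
have /set_dist_rangeP[x zx] := fnet z.
by exists x; rewrite iE /= gt_max epsr metric_sym (lt_trans zx).
Qed.

Theorem theoremB (R : realType) (X Y : metricType R)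
    (hX : non_archimedean X) (hY : non_archimedean Y)
    (eps : R) (heps : 0 < eps) :
  ((non_archimedean_GH X Y < eps%:E)%E ->
     exists f : X -> Y, strong_eps_isometry eps f) /\
  ((exists f : X -> Y, strong_eps_isometry eps f) ->
     (non_archimedean_GH X Y <= eps%:E)%E).
Proof.
split=> [/ereal_inf_lt[_ [Z [f [g [hZ fI gI ->]]]]]|[f fS]].
  move=> /hausdorff_dist_lt[r reps [fg gf]].
  exact: (exists_strong_eps_isometry hZ fI gI reps fg gf).
exact: (non_archimedean_GH_le hX hY heps fS).
Qed.
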